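(* Let $b>a>0$ and let $f:[a,b]\to\mathbb{R}$ be integrable on $[a,b]$. Let $F(x)=\int_a^x f(t)\,dt$ and $G(x)=\frac1x$ for $x\in[a,b]$. Then $$\left|\mathcal{T}(F,G)\right|\le\left|\frac1{ab}-\left(\frac{\ln b-\ln a}{b-a}\right)^2\right|^{1/2}\mathcal{T}^{1/2}(F,F),$$ where $$\mathcal{T}(F,F)=\frac1{b-a}\int_a^b\left(\int_a^x f(t)\,dt\right)^2dx-\left(\frac1{b-a}\int_a^b\left(\int_a^x f(t)\,dt\right)dx\right)^2.$$
   Context: The Chebyshev functional on $[a,b]$ is $$\mathcal{T}(u,v)=\frac1{b-a}\int_a^b u(t)v(t)\,dt-\frac1{b-a}\int_a^b u(t)\,dt\cdot\frac1{b-a}\int_a^b v(t)\,dt.$$ *)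

(* Defs.v *)
From HB Require Import structures.
From mathcomp Require Import all_boot all_order all_algebra.
From mathcomp Require Import all_classical all_reals all_analysis.

Set Implicit Arguments.
Unset Strict Implicit.
Unset Printing Implicit Defensive.

Import Order.TTheory GRing.Theory Num.Theory.
Import numFieldNormedType.Exports.

Local Open Scope classical_set_scope.
Local Open Scope ring_scope.

(* The integrals are those of the complete Lebesgue measure: the library's
   [lebesgue_measure] lives on the Borel sigma-algebra, for which a Lebesgue
   (or even Riemann) integrable function need not be measurable. *)

Definition chebyshev_functional {R : realType} (a b : R) (u v : R -> R) : R :=
  (b - a)^-1 * (\int[completed_lebesgue_measure]_(t in `[a, b]) (u t * v t))
  - ((b - a)^-1 * (\int[completed_lebesgue_measure]_(t in `[a, b]) u t))
    * ((b - a)^-1 * (\int[completed_lebesgue_measure]_(t in `[a, b]) v t)).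

(* Main.v *)
Require Import Defs.
From HB Require Import structures.
From mathcomp Require Import all_boot all_order all_algebra.
From mathcomp Require Import all_classical all_reals all_analysis.
From mathcomp Require Import measurable_realfun ring.

Set Implicit Arguments.
Unset Strict Implicit.
Unset Printing Implicit Defensive.

Import Order.TTheory GRing.Theory Num.Theory.
Import numFieldNormedType.Exports.

Local Open Scope classical_set_scope.
Local Open Scope ring_scope.

(** The Chebyshev functional is the covariance of two functions under the
    uniform probability on [a, b]. A variance, being the mean of a square, is
    nonnegative, so covariance is a positive semidefinite bilinear form and
    satisfies the Cauchy-Schwarz inequality T(u, v)^2 <= T(u, u) T(v, v)
    ([covar_sqr_le_bounded]). Taking v = 1/x, the fundamental theorem of
    calculus applied to 1/x and 1/x^2 shows that the factor under the square
    root is exactly the variance T(G, G) ([chebyshev_functional_inv]); being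
    nonnegative, it equals its absolute value.

    Cauchy-Schwarz needs F, G and their products to be integrable. This holds
    because both functions are measurable and bounded on [a, b]: F is bounded
    by the integral of |f|, and it is the difference of the primitives of the
    positive and negative parts of f, which are nondecreasing
    ([measurable_primitive]).

    The integrals are taken for the complete measure, whereas the fundamental
    theorem of calculus concerns the Borel one. The identity map, measurable
    from the complete sigma-algebra to the Borel one, pushes the complete
    measure forward to the Borel one, so that the two integrals of a Borel
    function agree ([ge0_Rintegral_completed]). *)

(** * Cauchy-Schwarz inequality for covariance *)

Lemma bounded_fun_mul (R : realType) (T : Type) (D : set T) (u v : T -> R) :
  [bounded u x | x in D] -> [bounded v x | x in D] ->
  [bounded u x * v x | x in D].
Proof.
move=> [M [_ uM]] [N [_ vN]].
(* the bound is only available above M and N, hence the added units *)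
exists ((`|M| + 1) * (`|N| + 1)); split; first exact: num_real.
move=> K /ltW leK x Dx; apply: le_trans leK; rewrite normrM.
by rewrite ler_pM//; [apply: uM|apply: vN] => //; rewrite ltr_pwDr// ler_norm.
Qed.

Section covariance.
Context d (T : measurableType d) (R : realType).
Variables (mu : {measure set T -> \bar R}) (D : set T) (c : R).

Definition covar (u v : T -> R) : R :=
  c^-1 * \int[mu]_(t in D) (u t * v t)
  - (c^-1 * \int[mu]_(t in D) u t) * (c^-1 * \int[mu]_(t in D) v t).

Hypotheses (mD : measurable D) (muD : mu D = c%:E) (c0 : 0 < c).

Let intg (u : T -> R) := mu.-integrable D (EFin \o u).

Let intgZ (r : R) u : intg u -> intg (fun t => r * u t).
Proof. exact: integrableZl. Qed.

Let intgD u v : intg u -> intg v -> intg (fun t => u t + v t).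
Proof. exact: integrableD. Qed.

Let intg_bounded (u : T -> R) :
  measurable_fun D u -> [bounded u x | x in D] -> intg u.
Proof.
by move=> mu_ bu; apply: measurable_bounded_integrable; rewrite ?muD ?ltry.
Qed.

Let intgM_bounded (u v : T -> R) :
  measurable_fun D u -> [bounded u x | x in D] ->
  measurable_fun D v -> [bounded v x | x in D] -> intg (fun t => u t * v t).
Proof.
by move=> mu_ bu mv bv; apply: intg_bounded;
  [exact: measurable_funM|exact: bounded_fun_mul].
Qed.

Let intg_cst r : intg (fun=> r).
Proof.
apply: intg_bounded => //.
by exists `|r|; split; [exact: num_real|move=> x rx t _; exact: ltW].
Qed.

(** With m the mean of w, this is the mean of the square of w - m. *)
Lemma covar_diag_ge0 (w : T -> R) : intg w -> intg (fun t => w t * w t) ->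
  0 <= covar w w.
Proof.
move=> iw iww; set m := c^-1 * \int[mu]_(t in D) w t.
have : 0 <= \int[mu]_(t in D) ((w t - m) ^+ 2).
  by apply: Rintegral_ge0 => t _; exact: sqr_ge0.
have -> : \int[mu]_(t in D) ((w t - m) ^+ 2) =
    \int[mu]_(t in D) ((w t * w t + (- (2 * m)) * w t) + m ^+ 2).
  by apply: eq_Rintegral => t _; ring.
rewrite !RintegralD ?RintegralZl ?Rintegral_cst//.
all: try by repeat (first [exact: intg_cst | exact: intgZ | apply: intgD]).
rewrite muD/= -(pmulr_rge0 _ (_ : 0 < c^-1)) ?invr_gt0//.
congr (_ <= _).
rewrite /covar -/m.
have -> : \int[mu]_(t in D) w t = c * m by rewrite /m mulVKf// gt_eqF.
by field; rewrite gt_eqF.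
Qed.

(** The variance of s u + t v is a nonnegative quadratic form in (s, t), so its
    discriminant is nonpositive. *)
Lemma covar_sqr_le (u v : T -> R) : intg u -> intg v ->
    intg (fun t => u t * u t) -> intg (fun t => u t * v t) ->
    intg (fun t => v t * v t) ->
  covar u v ^+ 2 <= covar u u * covar v v.
Proof.
move=> iu iv iuu iuv ivv.
have quad (s t : R) :
    0 <= s ^+ 2 * covar u u + 2 * s * t * covar u v + t ^+ 2 * covar v v.
  pose w x := s * u x + t * v x.
  have wwE : (fun x => w x * w x) = (fun x => s ^+ 2 * (u x * u x)
      + 2 * s * t * (u x * v x) + t ^+ 2 * (v x * v x)).
    by apply/funext => x; rewrite /w; ring.
  have iw : intg w by exact: intgD (intgZ s iu) (intgZ t iv).
  have iww : intg (fun x => w x * w x).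
    rewrite wwE; exact: intgD (intgD (intgZ _ iuu) (intgZ _ iuv)) (intgZ _ ivv).
  have := covar_diag_ge0 iw iww.
  congr (_ <= _).
  rewrite /covar.
  have -> : \int[mu]_(x in D) w x =
      s * \int[mu]_(x in D) u x + t * \int[mu]_(x in D) v x.
    by rewrite RintegralD ?RintegralZl//; exact: intgZ.
  rewrite wwE.
  rewrite !RintegralD ?RintegralZl//; first by ring.
  all: try exact: intgZ.
  exact: intgD (intgZ _ iuu) (intgZ _ iuv).
have : 0 <= covar v v by exact: covar_diag_ge0.
rewrite le_eqVlt => /predU1P[vv0|vv0].
  (* the form is now affine in t, and takes the value -1 unless it is constant *)
  rewrite -vv0 mulr0; have [->|uv0] := eqVneq (covar u v) 0.
    by rewrite expr0n.
  have := quad 1 (- (covar u u + 1) / (2 * covar u v)).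
  rewrite -vv0 (_ : _ + _ = -1) ?ler0N1//.
  by field; rewrite uv0.
(* the minimum of the form over t, up to scaling *)
have := quad (covar v v) (- covar u v).
rewrite (_ : _ + _ =
  covar v v * (covar u u * covar v v - covar u v ^+ 2)); last ring.
by rewrite pmulr_rge0// subr_ge0.
Qed.

Lemma covar_diag_ge0_bounded (u : T -> R) :
  measurable_fun D u -> [bounded u x | x in D] -> 0 <= covar u u.
Proof.
move=> mu_ bu.
by apply: covar_diag_ge0; [exact: intg_bounded|exact: intgM_bounded].
Qed.

Lemma covar_sqr_le_bounded (u v : T -> R) :
  measurable_fun D u -> [bounded u x | x in D] ->
  measurable_fun D v -> [bounded v x | x in D] ->
  covar u v ^+ 2 <= covar u u * covar v v.
Proof.
by move=> mu_ bu mv bv; apply: covar_sqr_le;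
  [exact: intg_bounded|exact: intg_bounded|exact: intgM_bounded..].
Qed.

End covariance.

(** * Borel functions under the complete Lebesgue measure *)

Section completed.
Context {R : realType}.
Local Notation lam := (@lebesgue_measure R).
Local Notation clam := (@completed_lebesgue_measure R).
Local Notation cR := (caratheodory_type (wlength (@idfun R))^*%mu).

Lemma completed_measurable_borel (A : set R) :
  measurable A -> @measurable _ cR A.
Proof. exact: sub_caratheodory. Qed.

Lemma completed_measurable_fun_borel (D : set R) (f : R -> R) :
  measurable D -> measurable_fun D f -> measurable_fun (D : set cR) f.
Proof.
by move=> mD mf _ B mB; apply: completed_measurable_borel; exact: mf.
Qed.

Lemma ge0_Rintegral_completed (D : set R) (f : R -> R) :
  measurable D -> measurable_fun D f -> (forall x, D x -> 0 <= f x) ->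
  \int[clam]_(x in D) f x = \int[lam]_(x in D) f x.
Proof.
move=> mD mf f0.
have mid : measurable_fun [set: cR] (id : cR -> measurableTypeR R).
  by move=> _ B mB; rewrite setTI; exact: completed_measurable_borel.
rewrite /Rintegral; congr fine.
rewrite -[LHS](@ge0_integral_pushforward _ _ _ _ _ _ mid clam D (EFin \o f) mD).
(* both measures are the restriction of one outer measure *)
- exact: eq_measure_integral.
- exact/measurable_EFinP.
- by move=> x; rewrite inE => /f0; rewrite lee_fin.
Qed.

Lemma completed_lebesgue_measure_itvcc (a b : R) :
  a < b -> clam `[a, b] = (b - a)%:E.
Proof.
move=> ab; transitivity (lam `[a, b]) => //.
by rewrite lebesgue_measure_itv/= lte_fin ab.
Qed.

End completed.

(** * The primitive of an integrable function *)

Section primitive.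
Context {R : realType}.
Local Notation clam := (@completed_lebesgue_measure R).
Local Notation cR := (caratheodory_type (wlength (@idfun R))^*%mu).

Let mitv (i : interval R) : @measurable _ cR [set` i].
Proof. by apply: completed_measurable_borel; exact: measurable_itv. Qed.

Lemma nondecreasing_primitive (a : R) (h : R -> R) :
  (forall x, 0 <= h x) -> clam.-integrable setT (EFin \o h) ->
  nondecreasing_fun (fun x => \int[clam]_(t in `[a, x]) h t).
Proof.
move=> h0 ih x y xy.
have ihS z : clam.-integrable `[a, z] (EFin \o h).
  by apply: integrableS ih => //; exact: mitv.
rewrite /Rintegral fine_le//; [exact: (integrable_fin_num _ (ihS x))|
  exact: (integrable_fin_num _ (ihS y))|].
apply: ge0_subset_integral; [exact: mitv|exact: mitv| | |].
- exact: measurable_int (ihS y).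
- by move=> t _; rewrite /= lee_fin.
- by apply: subset_itvl; rewrite bnd_simp.
Qed.

(** Monotone functions are Borel measurable, so it suffices to split the
    integrand into its positive and negative parts. The integrand is first
    extended by zero, because nothing is known about it outside [a, b]. *)
Lemma measurable_primitive (a b : R) (f : R -> R) :
  clam.-integrable `[a, b] (EFin \o f) ->
  measurable_fun `[a, b] (fun x => \int[clam]_(t in `[a, x]) f t).
Proof.
move=> intf; pose g := f \_ `[a, b].
have ig : clam.-integrable setT (EFin \o g).
  rewrite /g -restrict_EFin.
  exact: (@integrable_mkcond _ _ _ clam `[a, b] (EFin \o f) (mitv _)).1.
have igp := integrable_funrpos measurableT ig.
have ign := integrable_funrneg measurableT ig.
pose H h x := \int[clam]_(t in `[a, x]) h t.
apply: (eq_measurable_fun (fun x => H g^\+ x - H g^\- x)).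
  move=> x; rewrite inE/= in_itv/= => /andP[_ xb].
  rewrite /H -RintegralB.
  - apply: eq_Rintegral => t; rewrite inE/= in_itv/= => /andP[at_ tx].
    have -> : f t = g t.
      by rewrite /g patchE mem_set//= in_itv/= at_ (le_trans tx).
    by rewrite -[in RHS](funrposBneg g).
  - exact: mitv.
  - by apply: integrableS igp => //; exact: mitv.
  - by apply: integrableS ign => //; exact: mitv.
apply: measurable_funB; apply: nondecreasing_measurable => //;
  apply: nondecreasing_primitive => // x; rewrite ?funrpos_ge0 ?funrneg_ge0//.
Qed.

Lemma bounded_primitive (a b : R) (f : R -> R) :
  clam.-integrable `[a, b] (EFin \o f) ->
  [bounded (\int[clam]_(t in `[a, x]) f t : R) | x in `[a, b]].
Proof.
move=> intf.
exists (\int[clam]_(t in `[a, b]) `|f t|); split; first exact: num_real.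
move=> M /ltW leM x /=; rewrite in_itv/= => /andP[ax xb]; apply: le_trans leM.
have xbS : `[a, x] `<=` `[a, b] by apply: subset_itvl; rewrite bnd_simp.
have intfx : clam.-integrable `[a, x] (EFin \o f).
  by apply: integrableS intf => //; exact: mitv.
apply: (le_trans (le_normr_Rintegral (mitv _) intfx)).
have nf z := @integrable_norm _ _ _ clam `[a, z] f.
rewrite /Rintegral fine_le//.
- exact: (integrable_fin_num _ (nf _ intfx)).
- exact: (integrable_fin_num _ (nf _ intf)).
apply: ge0_subset_integral; [exact: mitv|exact: mitv| | |by []].
- exact: measurable_int (nf _ intf).
- by move=> t _; rewrite /= lee_fin.
Qed.

End primitive.

(** * The variance of the inverse function *)

Section inverse.
Context {R : realType} (a b : R) (ha : 0 < a) (hab : a < b).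
Local Notation lam := (@lebesgue_measure R).

Lemma within_continuous_inv : {within `[a, b], continuous (fun x : R => x^-1)}.
Proof.
apply: continuous_in_subspaceT => x; rewrite inE/= in_itv/= => /andP[ax _].
by apply: inv_continuous; rewrite gt_eqF// (lt_le_trans ha).
Qed.

Lemma measurable_fun_inv : measurable_fun `[a, b] (fun x : R => x^-1).
Proof.
apply: subspace_continuous_measurable_fun; first exact: measurable_itv.
exact: within_continuous_inv.
Qed.

Lemma bounded_inv : [bounded (x^-1 : R) | x in `[a, b]].
Proof.
exists a^-1; split; first exact: num_real.
move=> M /ltW leM x /=; rewrite in_itv/= => /andP[ax xb].
apply: le_trans leM; have x0 := lt_le_trans ha ax.
by rewrite ger0_norm ?invr_ge0 ?(ltW x0)// lef_pV2.
Qed.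

Lemma Rintegral_inv : \int[lam]_(x in `[a, b]) x^-1 = ln b - ln a.
Proof.
rewrite /Rintegral (@continuous_FTC2 _ _ (@ln R))//.
- exact: within_continuous_inv.
- split.
  + move=> x; rewrite in_itv/= => /andP[ax _].
    by case: (is_derive1_ln (lt_trans ha ax)).
  + by apply: cvg_at_right_filter; exact: continuous_ln.
  + by apply: cvg_at_left_filter; apply: continuous_ln; exact: lt_trans hab.
- move=> x; rewrite in_itv/= => /andP[ax _].
  rewrite derive1E.
  by rewrite (@derive_val _ _ _ _ _ _ _ (is_derive1_ln (lt_trans ha ax))).
Qed.

Lemma Rintegral_inv_sqr :
  \int[lam]_(x in `[a, b]) (x^-1 * x^-1) = a^-1 - b^-1.
Proof.
have der x : a < x -> is_derive x 1 (fun y : R => - y^-1) (x^-1 * x^-1).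
  move=> ax; have x0 : x != 0 by rewrite gt_eqF// (lt_trans ha).
  have := is_deriveN (is_deriveV x0 (is_derive_id x 1)).
  by rewrite /GRing.scale/= mulr1 opprK expr2 invfM.
rewrite /Rintegral (@continuous_FTC2 _ _ (fun y => - y^-1))//.
- by rewrite -EFinB /= opprK addrC.
- have cV := within_continuous_inv.
  by move=> x; apply: cvgM; exact: cV.
- have cN x : a <= x -> {for x, continuous (fun y : R => - y^-1)}.
    move=> ax; apply: continuousN; apply: inv_continuous.
    by rewrite gt_eqF// (lt_le_trans ha).
  split.
  + by move=> x; rewrite in_itv/= => /andP[ax _]; case: (der x ax).
  + by apply: cvg_at_right_filter; exact: cN.
  + by apply: cvg_at_left_filter; apply: cN; exact: ltW.
- move=> x; rewrite in_itv/= => /andP[ax _].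
  by rewrite derive1E (@derive_val _ _ _ _ _ _ _ (der x ax)).
Qed.

Lemma chebyshev_functional_inv :
  chebyshev_functional a b (fun x => x^-1) (fun x => x^-1) =
  1 / (a * b) - ((ln b - ln a) / (b - a)) ^+ 2.
Proof.
have mab : measurable (`[a, b] : set R) by exact: measurable_itv.
have x0 (x : R) : `[a, b]%classic x -> 0 <= x^-1.
  rewrite /= in_itv/= => /andP[ax _].
  by rewrite invr_ge0 ltW// (lt_le_trans ha).
have mV := measurable_fun_inv.
rewrite /chebyshev_functional (ge0_Rintegral_completed mab mV)//.
rewrite (ge0_Rintegral_completed mab (measurable_funM mV mV)).
  rewrite Rintegral_inv Rintegral_inv_sqr.
  by field; rewrite subr_eq0 !gt_eqF// (lt_trans ha).
by move=> x xab; rewrite mulr_ge0 ?x0.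
Qed.

End inverse.

(** * The inequality *)

Theorem proposition2 (R : realType) (a b : R) (ha : 0 < a) (hab : a < b)
    (f : R -> R)
    (hf : (@completed_lebesgue_measure R).-integrable `[a, b]
            (fun t => (f t)%:E)) :
  let F := fun x : R =>
    \int[completed_lebesgue_measure]_(t in `[a, x]) f t in
  let G := fun x : R => 1 / x in
  `|chebyshev_functional a b F G|
    <= Num.sqrt `|1 / (a * b) - ((ln b - ln a) / (b - a)) ^+ 2|
       * Num.sqrt (chebyshev_functional a b F F)
  /\ chebyshev_functional a b F F =
     (b - a)^-1 * (\int[completed_lebesgue_measure]_(x in `[a, b])
        (\int[completed_lebesgue_measure]_(t in `[a, x]) f t) ^+ 2)
     - ((b - a)^-1 * (\int[completed_lebesgue_measure]_(x in `[a, b])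
        (\int[completed_lebesgue_measure]_(t in `[a, x]) f t))) ^+ 2.
Proof.
move=> F G; split => //.
have GE : G = fun x => x^-1 by apply/funext => x; rewrite /G div1r.
have mab : measurable (`[a, b] : set R) by exact: measurable_itv.
have cab := completed_measurable_borel mab.
have muab := completed_lebesgue_measure_itvcc hab.
have ba0 : 0 < b - a by rewrite subr_gt0.
have mF : measurable_fun `[a, b] F by exact: measurable_primitive.
have cmF := completed_measurable_fun_borel mab mF.
have bF : [bounded F x | x in `[a, b]] by exact: bounded_primitive.
have cmG := completed_measurable_fun_borel mab (@measurable_fun_inv _ _ b ha).
have bG := @bounded_inv _ _ b ha.
rewrite GE -chebyshev_functional_inv// -sqrtrM ?normr_ge0//.
rewrite -sqrtr_sqr ler_wsqrtr//.
have GG0 : 0 <= chebyshev_functional a b (fun x : R => x^-1) (fun x => x^-1).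
  exact: (covar_diag_ge0_bounded cab muab ba0 cmG bG).
rewrite ger0_norm// mulrC.
exact: (covar_sqr_le_bounded cab muab ba0 cmF bF cmG bG).
Qed.
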